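(* Let $n\in\mathbb{N}$. Suppose that $\mathcal{C}\subseteq\{0,1\}^n$ is an extremal class of VC dimension $d$ containing a maximum class $\mathcal{D}\subseteq\{0,1\}^n$ of VC dimension $d-1$. Then $\mathcal{C}$ has an unlabelled compression scheme of size $d$.
   Context: $[n]=\{1,\dots,n\}$; $\mathrm{proj}_I(v)=(v_i)_{i\in I}$ for $I\subseteq[n]$, and $\mathrm{proj}_I(\mathcal{C})=\{\mathrm{proj}_I(v):v\in\mathcal{C}\}$. A class $\mathcal{C}\subseteq\{0,1\}^n$ shatters $I$ if $\mathrm{proj}_I(\mathcal{C})=\{0,1\}^{|I|}$; its VC dimension is the maximum of $|I|$ over shattered $I$. A cube with colour set $I\subseteq[n]$ is a set of all points of $\{0,1\}^n$ having prescribed values on $[n]\setminus I$. $\mathcal{C}$ is extremal if whenever $\mathcal{C}$ shatters $I$, $\mathcal{C}$ contains a cube with colour set $I$. A class $\mathcal{D}\subseteq\{0,1\}^n$ of VC dimension $e$ is maximum if $|\mathcal{D}|=\sum_{i=0}^{e}\binom{n}{i}$. An unlabelled compression scheme (representation mapping) of size $k$, where $k<n$, of $\mathcal{C}$ is a map $r$ such that (1) $r$ is an injection from $\mathcal{C}$ to the subsets of $[n]$ of size at most $k$, and (2) (non-clashing) $\mathrm{proj}_{r(v)\cup r(v')}(v)\neq\mathrm{proj}_{r(v)\cup r(v')}(v')$ for all $v\neq v'$ in $\mathcal{C}$.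
   Formalization: The proviso k < n in the definition of an unlabelled compression scheme of size k is dropped: with it the claim fails for d = n (e.g. n = 1, C = {0,1}, D = {0}); for d < n the statement is unchanged. *)

(* Defs.v *)
From mathcomp Require Import all_boot.

Set Implicit Arguments.
Unset Strict Implicit.
Unset Printing Implicit Defensive.

(* The colours 1, ..., n are the elements 0, ..., n-1 of 'I_n. *)
Definition point (n : nat) : finType := {ffun 'I_n -> bool}.

Definition subpoint (n : nat) (I : {set 'I_n}) : finType :=
  {ffun {i : 'I_n | i \in I} -> bool}.

Definition proj (n : nat) (I : {set 'I_n}) (v : point n) : subpoint I :=
  [ffun i : {i : 'I_n | i \in I} => v (val i)].

Definition shatters (n : nat) (C : {set point n}) (I : {set 'I_n}) : bool :=
  [set proj I v | v in C] == [set: subpoint I].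

(* The empty class shatters nothing, not even set0; its value here is 0. *)
Definition vcdim (n : nat) (C : {set point n}) : nat :=
  \max_(I : {set 'I_n} | shatters C I) #|I|.

Definition cube (n : nat) (I : {set 'I_n}) (u : subpoint (~: I)) :
    {set point n} :=
  [set v | proj (~: I) v == u].

Definition extremal (n : nat) (C : {set point n}) : Prop :=
  forall I : {set 'I_n}, shatters C I ->
    exists u : subpoint (~: I), cube u \subset C.

(* The empty class is not maximum: the sum is at least 'C(n, 0) = 1. *)
Definition maximum_class (n : nat) (D : {set point n}) : Prop :=
  #|D| = \sum_(0 <= i < (vcdim D).+1) 'C(n, i).

(* Only the values of r on C matter. The usual proviso k < n is not imposed:
   the full cube, of VC dimension n, has no scheme of size less than n, while
   sending each point to its support is one of size n. *)
Definition compression_scheme (n : nat) (C : {set point n}) (k : nat)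
    (r : point n -> {set 'I_n}) : Prop :=
  [/\ {in C &, injective r},
      {in C, forall v, #|r v| <= k} &
      {in C &, forall v w, v != w ->
         proj (r v :|: r w) v != proj (r v :|: r w) w}].

Definition has_compression_scheme (n : nat) (C : {set point n}) (k : nat) :
    Prop :=
  exists r : point n -> {set 'I_n}, compression_scheme C k r.

(* Main.v *)
Require Import Defs.
From mathcomp Require Import all_boot all_algebra.

(** Let C have VC dimension d and D, contained in C, be maximum of dimension
    d - 1; identify points with sets of colours.  For each shattered set S of
    size d, C contains a cube B_S with colour set S, and D misses a label f_S on
    S; let s_S be the vertex of B_S with label f_S.  A compression scheme of D is
    extended to C by sending s_S to S.

    That S |-> s_S is a bijection onto C \ D is linear algebra.  Let h_S be the
    indicator function of the points with label f_S on S and L_S the alternating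
    sum over B_S, with sign + at s_S.  Then h_S vanishes on D and L_S h_S' is 1
    if S = S' and 0 otherwise, so (L_S)_S and (h_S)_S, seen as matrices indexed by
    pairs of a set S and a point of C \ D, satisfy L h = 1.  By Pajor's inequality
    there are at least as many sets S as points of C \ D, so h L = 1 as well, and
    the diagonal entry of h L at v counts the S with s_S = v.  The same argument
    on the projections to any J gives that no two s_S with S contained in J agree
    on J; with J = S :|: S' this is the non-clashing condition.

    A maximum class D is handled by induction on the number of colours: the
    reduction D^x is maximum of one dimension less, is contained in the
    restriction D_x, and a scheme of D_x extending one of D^x lifts to D. *)

Set Implicit Arguments.
Unset Strict Implicit.
Unset Printing Implicit Defensive.

(** * Shattering, restriction and reduction in set families *)

Section Families.

Variable T : finType.
Implicit Types (F C D : {set {set T}}) (A B S J U X : {set T}) (x : T).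

Definition trace F S := [set A :&: S | A in F].
Definition shattered F S := powerset S \subset trace F S.
Definition restriction x F := [set A :\ x | A in F].
Definition reduction x F := [set A in F | (x \notin A) && (x |: A \in F)].
Definition small_subsets U e := [set S : {set T} | (S \subset U) && (#|S| < e)].

Lemma shatteredP F S :
  reflect (forall X, X \subset S -> exists2 A, A \in F & A :&: S = X)
          (shattered F S).
Proof.
apply: (iffP subsetP) => [sh X XS | sh X].
  by have /sh/imsetP[A AF ->] : X \in powerset S by [rewrite inE]; exists A.
by rewrite inE => /sh[A AF <-]; apply: imset_f.
Qed.

Lemma shattered_powerset F U S : F \subset powerset U -> shattered F S -> S \subset U.
Proof.
move=> /subsetP FU /shatteredP /(_ S (subxx _)) [A /FU]; rewrite inE => AU <-.
exact: subset_trans (subsetIl _ _) AU.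
Qed.

Lemma shattered_trace F S J : S \subset J -> shattered (trace F J) S = shattered F S.
Proof.
move=> SJ; apply/shatteredP/shatteredP => sh X /sh[A].
  by case/imsetP=> B BF -> <-; exists B; rewrite // -setIA (setIidPr SJ).
by move=> AF <-; exists (A :&: J); [apply: imset_f | rewrite -setIA (setIidPr SJ)].
Qed.

Lemma restriction_trace x F U :
  F \subset powerset U -> restriction x F = trace F (U :\ x).
Proof.
move=> /subsetP FU; apply: eq_in_imset => A /FU; rewrite inE => /setIidPl AU.
by rewrite setIDA AU.
Qed.

Lemma restriction_powerset x F U :
  F \subset powerset U -> restriction x F \subset powerset (U :\ x).
Proof.
move=> /subsetP FU; apply/subsetP => _ /imsetP[A /FU + ->].
by rewrite !powersetE; exact: setSD.
Qed.

Lemma reduction_powerset x F U :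
  F \subset powerset U -> reduction x F \subset powerset (U :\ x).
Proof.
move=> /subsetP FU; apply/subsetP => A; rewrite !inE => /and3P[/FU].
by rewrite inE subsetD1 => -> ->.
Qed.

Lemma setD1_id x A : x \notin A -> A :\ x = A.
Proof. by move=> xA; apply/setDidPl; rewrite disjoint_sym disjoints1. Qed.

Lemma reduction_restriction x F : reduction x F \subset restriction x F.
Proof.
apply/subsetP => A; rewrite inE => /and3P[AF xA _].
by apply/imsetP; exists A; rewrite ?setD1_id.
Qed.

(** Split [F] by membership of [x] and delete [x] from the second half: the union of the two halves
    is then the restriction, and their intersection the reduction. *)
Lemma card_restriction_reduction x F :
  #|restriction x F| + #|reduction x F| = #|F|.
Proof.
pose F0 := [set A in F | x \notin A]; pose F1 := [set A in F | x \in A].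
pose F1' := [set A :\ x | A in F1].
have F0E A : (A \in F0) = (A \in F) && (x \notin A) by rewrite inE.
have F1E A : (A \in F1') = (x \notin A) && (x |: A \in F).
  apply/imsetP/andP => [[B] | [xA xAF]].
    by rewrite inE => /andP[BF xB] ->; rewrite !inE eqxx setD1K.
  by exists (x |: A); rewrite ?setU1K // inE xAF setU11.
have -> : restriction x F = F0 :|: F1'.
  apply/setP => A; rewrite inE F0E F1E; apply/imsetP/idP => [[B BF ->]|].
    rewrite !inE eqxx andbT; have [xB|xB] := boolP (x \in B).
      by rewrite setD1K // BF orbT.
    by rewrite setD1_id ?BF.
  case/orP=> /andP[]; first by exists A; rewrite ?setD1_id.
  by exists (x |: A); rewrite ?setU1K.
have -> : reduction x F = F0 :&: F1'.
  by apply/setP => A; rewrite !in_setI F0E F1E !inE; case: (x \in A);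
    rewrite ?andbF ?andbT.
rewrite cardsUI card_in_imset; last first.
  move=> A B; rewrite !inE => /andP[_ xA] /andP[_ xB] /(congr1 (setU [set x])).
  by rewrite !setD1K.
rewrite -[RHS](cardsID F1) addnC; congr (_ + _); apply: eq_card => A.
  by rewrite !inE andbA andbb.
by rewrite !inE; case: (A \in F); rewrite ?andbT ?andbF.
Qed.

Lemma shattered_reduction x F S :
  shattered (reduction x F) S -> x \notin S /\ shattered F (x |: S).
Proof.
move=> /shatteredP sh.
have xS : x \notin S.
  apply/negP => xS; have [A] := sh S (subxx _).
  by rewrite inE => /and3P[_ xA _] AS; rewrite -AS inE (negPf xA) in xS.
split=> //; apply/shatteredP => X XS.
have [|A] := sh (X :\ x); first by rewrite subDset.
rewrite inE => /and3P[AF xA xAF] AS.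
have [xX|xX] := boolP (x \in X).
  by exists (x |: A) => //; rewrite -setUIr AS setD1K.
exists A; rewrite // -[X in _ = X](setD1_id xX) -AS.
by apply/setP => y; rewrite !inE; case: eqP => // ->; rewrite (negPf xA).
Qed.

Lemma shattered_restriction x F S :
  x \notin S -> shattered (restriction x F) S = shattered F S.
Proof.
move=> xS; have E A : (A :\ x) :&: S = A :&: S.
  by rewrite setIDAC setD1_id // inE (negPf xS) andbF.
apply/shatteredP/shatteredP => sh X /sh[A].
  by case/imsetP=> B BF ->; rewrite E; exists B.
by move=> AF AX; exists (A :\ x); rewrite ?E //; apply: imset_f.
Qed.

(** Pajor's inequality, by induction on the ground set. Sets shattered by the restriction avoid [x];
    each set [S] shattered by the reduction gives the set [x |: S], also shattered by [F]. The two
    collections are disjoint, so their sizes add. *)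
Lemma card_le_shattered F U :
  F \subset powerset U ->
  #|F| <= #|[set S : {set T} | (S \subset U) && shattered F S]|.
Proof.
have [k] := ubnP #|U|; elim: k U F => // k IHk U F leUk FU.
have [U0 | [x xU]] := set_0Vmem U.
  have [-> | [A AF]] := set_0Vmem F; first by rewrite cards0.
  apply: leq_trans (_ : #|powerset U| <= _); first exact: subset_leq_card.
  rewrite U0 powerset0 cards1 card_gt0; apply/set0Pn; exists set0.
  rewrite inE sub0set; apply/shatteredP => X.
  by rewrite subset0 => /eqP ->; exists A; rewrite // setI0.
have ltUk : #|U :\ x| < k by move: leUk; rewrite (cardsD1 x) xU.
have IHr := IHk _ _ ltUk (restriction_powerset x FU).
have IHd := IHk _ _ ltUk (reduction_powerset x FU).
rewrite -(card_restriction_reduction x F).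
apply: leq_trans (leq_add IHr IHd) _.
set L := [set S | _]; set R := [set S | _].
have xR S : S \in R -> x \notin S.
  by rewrite inE subsetD1 => /andP[/andP[]].
rewrite -(card_in_imset (f := setU [set x]) (D := R)); last first.
  by move=> A B /xR xA /xR xB E; rewrite -(setU1K xA) -(setU1K xB) E.
rewrite -cardsUI [X in _ + X](_ : _ = 0) ?addn0.
  apply: subset_leq_card; apply/subsetP => S; rewrite !inE.
  case/orP=> [|/imsetP[B]].
    by rewrite subsetD1 => /andP[/andP[-> xS]]; rewrite shattered_restriction.
  rewrite inE subsetD1 => /andP[/andP[BU _] /shattered_reduction[_ sh]] ->.
  by rewrite sh subUset sub1set xU BU.
apply/eqP; rewrite cards_eq0; apply/set0Pn => -[S]; rewrite !inE.
case/andP=> /andP[+ _] /imsetP[B _ E].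
by rewrite E subsetD1 setU11 andbF.
Qed.

(** * The Sauer bound and maximum families *)

Lemma sauer F U e :
  F \subset powerset U -> (forall S, shattered F S -> #|S| < e) ->
  #|F| <= #|small_subsets U e|.
Proof.
move=> FU vc; apply: leq_trans (card_le_shattered FU) _.
apply: subset_leq_card; apply/subsetP => S.
by rewrite !inE => /andP[-> /vc].
Qed.

Lemma small_subsets0 U : small_subsets U 0 = set0.
Proof. by apply/setP => S; rewrite !inE andbF. Qed.

(** Pascal's rule: the restriction and the reduction of a family of small subsets are again such
    families on [U :\ x]. *)
Lemma card_small_subsetsS x U e : x \in U ->
  #|small_subsets U e.+1| =
    #|small_subsets (U :\ x) e.+1| + #|small_subsets (U :\ x) e|.
Proof.
move=> xU; rewrite -(card_restriction_reduction x).
have -> : restriction x (small_subsets U e.+1) = small_subsets (U :\ x) e.+1.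
  apply/setP => S; apply/imsetP/idP => [[B] | ].
    rewrite !inE => /andP[BU Be] ->; rewrite setSD //=.
    exact: leq_ltn_trans (subset_leq_card (subD1set _ _)) Be.
  rewrite inE subsetD1 => /andP[/andP[SU xS] Se].
  by exists S; rewrite ?setD1_id // inE SU.
congr (_ + _); apply: eq_card => S.
rewrite !inE subUset sub1set xU subsetD1 /= cardsU1.
case: (x \in S); rewrite ?andbF //= !andbT add1n !ltnS.
by case: (S \subset U) => //=; rewrite andbC; case: ltnP => // /ltnW ->.
Qed.

Lemma card_small_subsets U e :
  #|small_subsets U e| = \sum_(0 <= i < e) 'C(#|U|, i).
Proof.
elim: e => [|e IHe]; first by rewrite small_subsets0 cards0 big_geq.
rewrite big_nat_recr //= -IHe -cards_draws.
rewrite -[LHS](cardsID (small_subsets U e)) (setIidPr _); last first.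
  by apply/subsetP => S; rewrite !inE => /andP[-> /ltnW].
congr (_ + _); apply: eq_card => S; rewrite !inE ltnS.
by case: (S \subset U); rewrite ?andbF //= -leqNgt eqn_leq andbC.
Qed.

(* [e] is one more than the VC dimension, so that [e = 0] is the empty class. *)
Definition maximum_family U e F :=
  [/\ F \subset powerset U, forall S, shattered F S -> #|S| < e
    & #|F| = #|small_subsets U e|].

Lemma maximum_family0 U F : maximum_family U 0 F -> F = set0.
Proof. by case=> _ _; rewrite small_subsets0 cards0 => /cards0_eq. Qed.

(** By Pascal's rule the Sauer bounds for the two parts add up to the size of [F], so neither can be
    strict. *)
Lemma maximum_restriction_reduction x U e F :
  x \in U -> maximum_family U e.+1 F ->
  maximum_family (U :\ x) e.+1 (restriction x F) /\
  maximum_family (U :\ x) e (reduction x F).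
Proof.
move=> xU [FU vc cardF].
have FxU := restriction_powerset x FU; have RxU := reduction_powerset x FU.
have vcF S : shattered (restriction x F) S -> #|S| < e.+1.
  move=> sh; have := shattered_powerset FxU sh; rewrite subsetD1 => /andP[_ xS].
  by apply: vc; rewrite -(shattered_restriction _ xS).
have vcR S : shattered (reduction x F) S -> #|S| < e.
  by case/shattered_reduction => xS /vc; rewrite cardsU1 xS.
have leF := sauer FxU vcF; have leR := sauer RxU vcR.
have := card_restriction_reduction x F; rewrite cardF (card_small_subsetsS e xU).
move=> E; split; split=> //; apply/eqP; rewrite eqn_leq ?leF ?leR /=.
  by rewrite -(leq_add2r #|reduction x F|) E leq_add2l.
by rewrite -(leq_add2l #|restriction x F|) E leq_add2r.
Qed.

Lemma maximum_restriction x U e F :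
  x \in U -> maximum_family U e F ->
  maximum_family (U :\ x) e (restriction x F).
Proof.
case: e => [|e] xU maxF; last by case: (maximum_restriction_reduction xU maxF).
rewrite (maximum_family0 maxF) /restriction imset0; split.
- exact: sub0set.
- by move=> S /shatteredP /(_ S (subxx _))[A]; rewrite inE.
- by rewrite small_subsets0.
Qed.

(** The colours outside [J] are removed one at a time by restriction. *)
Lemma maximum_trace U e F J :
  J \subset U -> maximum_family U e F -> maximum_family J e (trace F J).
Proof.
have [k] := ubnP #|U :\: J|; elim: k U F => // k IHk U F ltk JU maxF.
have [UJ | [x]] := set_0Vmem (U :\: J).
  have <- : U = J by apply/eqP; rewrite eqEsubset JU -setD_eq0 UJ eqxx.
  rewrite (_ : trace F U = F) //; have [/subsetP FU _ _] := maxF.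
  rewrite -[RHS]imset_id; apply: eq_in_imset => A /FU.
  by rewrite inE => /setIidPl.
rewrite inE => /andP[xJ xU].
have JUx : J \subset U :\ x by rewrite subsetD1 JU.
have -> : trace F J = trace (restriction x F) J.
  have [FU _ _] := maxF; rewrite (restriction_trace _ FU) /trace -imset_comp.
  by apply: eq_imset => A; rewrite /= -setIA (setIidPr JUx).
apply: IHk JUx (maximum_restriction xU maxF).
have -> : (U :\ x) :\: J = (U :\: J) :\ x by rewrite !setDDl setUC.
by move: ltk; rewrite (cardsD1 x (U :\: J)) inE xJ xU.
Qed.

Definition cube_at S A := [set B : {set T} | B :\: S == A :\: S].

(** A cube of the reduction with colours [S :\ x] doubles along [x] to a cube of [F]. This provides
    the cubes needed when a scheme is extended from the reduction to the restriction. *)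
Lemma maximum_cube U e F S :
  maximum_family U e F -> S \subset U -> #|S| < e ->
  exists A, cube_at S A \subset F.
Proof.
have [k] := ubnP #|S|; elim: k U e F S => // k IHk U e F S ltk maxF SU.
have [-> | [x xS]] := set_0Vmem S.
  move=> e0; have : 0 < #|F|.
    have [_ _ ->] := maxF; rewrite card_gt0; apply/set0Pn; exists set0.
    by rewrite inE sub0set.
  rewrite card_gt0 => /set0Pn[A AF]; exists A; apply/subsetP => B.
  by rewrite inE !setD0 => /eqP ->.
case: e maxF => // e maxF; rewrite (cardsD1 x) xS ltnS => lte.
have xU := subsetP SU x xS.
have [_ maxR] := maximum_restriction_reduction xU maxF.
have [|A AR] := IHk _ _ _ (S :\ x) _ maxR (setSD _ SU) lte.
  by move: ltk; rewrite (cardsD1 x S) xS.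
have [RU _ _] := maxR.
have xA : x \notin A.
  have : A \in reduction x F by apply: (subsetP AR); rewrite inE.
  by rewrite inE => /and3P[].
exists A; apply/subsetP => B; rewrite inE => /eqP BA.
have : B :\ x \in reduction x F.
  apply: (subsetP AR); rewrite inE setDDl setD1K // BA.
  by rewrite -[X in A :\: X == _](setD1K xS) -setDDl setD1_id.
rewrite inE => /and3P[BF _ xBF].
by have [xB|xB] := boolP (x \in B); [rewrite -(setD1K xB) | rewrite -(setD1_id xB)].
Qed.

End Families.

(** * Dual systems and alternating sums over cubes *)

Section LinearAlgebra.
Import GRing.Theory Num.Theory.
Local Open Scope ring_scope.

(** A product equal to the identity of size [m] forces [m <= k], so the matrices are square. *)
Lemma mulmx1_swap (R : comNzRingType) m k (A : 'M[R]_(m, k)) (B : 'M_(k, m)) :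
  (k <= m)%N -> A *m B = 1%:M -> B *m A = 1%:M.
Proof.
move=> lekm AB; have Emk : m = k.
  by apply/eqP; rewrite eqn_leq lekm (mulmx1_min AB).
by case: _ / Emk A B AB {lekm} => A B /mulmx1C.
Qed.

Lemma dual_system_swap (R : comNzRingType) (X Y : finType)
    (I : {set X}) (P : {set Y}) (M : X -> Y -> R) (H : Y -> X -> R) :
  (#|P| <= #|I|)%N ->
  {in I &, forall i j, \sum_(p in P) M i p * H p j = (i == j)%:R} ->
  {in P, forall p, \sum_(i in I) H p i * M i p = 1}.
Proof.
move=> lePI MH p pP.
pose A := \matrix_(i < #|I|, j < #|P|) M (enum_val i) (enum_val j).
pose B := \matrix_(j < #|P|, i < #|I|) H (enum_val j) (enum_val i).
have /(mulmx1_swap lePI)/matrixP : A *m B = 1%:M.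
  apply/matrixP => i j; rewrite !mxE -(inj_eq enum_val_inj).
  rewrite -(MH _ _ (enum_valP i) (enum_valP j)).
  by rewrite [RHS]big_enum_val; apply: eq_bigr => q _; rewrite !mxE.
move=> /(_ (enum_rank_in pP p) (enum_rank_in pP p)); rewrite !mxE eqxx mulr1n => <-.
rewrite big_enum_val; apply: eq_bigr => i _.
by rewrite !mxE enum_rankK_in.
Qed.

Definition toggle (T : finType) (x : T) (A : {set T}) :=
  if x \in A then A :\ x else x |: A.

Lemma toggle_neq (T : finType) (x y : T) A : (y != x) -> (y \in toggle x A) = (y \in A).
Proof. by rewrite /toggle => /negPf yx; case: ifP; rewrite !inE yx. Qed.

Lemma toggleK (T : finType) (x : T) : involutive (toggle x).
Proof.
move=> A; rewrite /toggle; have [xA|xA] := boolP (x \in A).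
  by rewrite in_setD1 eqxx setD1K.
by rewrite setU11 setU1K.
Qed.

Lemma sign_card_toggle (T : finType) (x : T) (A S : {set T}) : x \in S ->
  (-1) ^+ #|toggle x A :&: S| = - (-1) ^+ #|A :&: S| :> int.
Proof.
move=> xS; rewrite /toggle; case: ifP => xA.
  rewrite [in RHS](cardsD1 x) inE xA xS add1n exprS mulN1r opprK.
  by rewrite setIDAC.
rewrite (cardsD1 x (_ :&: _)) !inE eqxx xS add1n exprS mulN1r.
by rewrite -setIDAC setU1K // xA.
Qed.

(* The toggling of a colour in [S] but not in [S'] reverses the sign. *)
Lemma alternating_sum0 (T : finType) (S S' Q Q' : {set T}) : ~~ (S \subset S') ->
  \sum_(p : {set T} | p :\: S == Q)
     (-1) ^+ #|p :&: S| * (p :&: S' == Q')%:R = 0 :> int.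
Proof.
case/subsetPn=> x xS xS'; set s := LHS.
suff : s == - s by rewrite -subr_eq0 opprK -mulr2n mulrn_eq0 /= => /eqP.
rewrite -sumrN {1}/s (reindex_inj (inv_inj (@toggleK _ x))); apply/eqP.
apply: eq_big => [p | p _].
  congr (_ == Q); apply/setP => y; rewrite !inE.
  by have [->|yx] := eqVneq y x; rewrite ?xS // toggle_neq.
rewrite sign_card_toggle // mulNr; congr (- (_ * (_ == Q')%:R)).
apply/setP => y; rewrite !inE.
by have [->|yx] := eqVneq y x; rewrite ?(negPf xS') ?andbF // toggle_neq.
Qed.

End LinearAlgebra.

(** * The bijection between top shattered sets and points outside the maximum family *)

Section Sources.

Variables (T : finType) (U : {set T}) (d : nat) (C D : {set {set T}}).
Variables corner label : {set T} -> {set T}.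
Implicit Types (S J p : {set T}).

Hypothesis maxD : maximum_family U d D.
Hypothesis vcC : forall S, shattered C S -> #|S| <= d.

Definition top_sets J := [set S : {set T} | [&& S \subset J, #|S| == d & shattered C S]].

Hypothesis label_sub : forall S, S \in top_sets U -> label S \subset S.
Hypothesis label_missed : forall S, S \in top_sets U -> label S \notin trace D S.
Hypothesis cornerC : forall S, S \in top_sets U -> cube_at S (corner S) \subset C.

(** This is the vertex s_S: [corner S] serves only to fix the cube, and [label S] selects the vertex
    in it. *)
Definition source S := (corner S :\: S) :|: label S.

Lemma top_setsS J S : J \subset U -> S \in top_sets J -> S \in top_sets U.
Proof. by move=> JU; rewrite !inE => /andP[SJ ->]; rewrite (subset_trans SJ JU). Qed.

Lemma sourceD S : S \in top_sets U -> source S :\: S = corner S :\: S.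
Proof.
move=> /label_sub/subsetP lS; apply/setP => y; rewrite !inE.
by case: (boolP (y \in S)) => //= yS; rewrite (contraNF (lS y)) // orbF.
Qed.

Lemma sourceI S : S \in top_sets U -> source S :&: S = label S.
Proof.
move=> /label_sub/subsetP lS; apply/setP => y; rewrite !inE.
case: (boolP (y \in S)) => /= yS; first by rewrite andbT.
by rewrite andbF (contraNF (lS y)).
Qed.

Lemma source_in S : S \in top_sets U -> source S \in C.
Proof.
by move=> St; apply: (subsetP (cornerC St)); rewrite inE sourceD.
Qed.

Import GRing.Theory Num.Theory.
Local Open Scope ring_scope.

(* A function on the trace of [C] that vanishes on that of [D] is determined by
   its alternating sums over the top cubes: [M] and [H] are mutually inverse. *)
Lemma card_source J p : J \subset U -> D \subset C ->
  p \in trace C J :\: trace D J ->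
  #|[set S in top_sets J | source S :&: J == p]| = 1%N.
Proof.
move=> JU DC pP.
(* Alternating sum over the trace on [J] of the cube of [S]; the term [#|label S|] in the exponent
   makes the sign at the trace of [source S] positive. *)
pose M S p : int := (p :\: S == (corner S :&: J) :\: S)%:R *
  (-1) ^+ (#|p :&: S| + #|label S|).
pose H p S : int := (p :&: S == label S)%:R.
(* Pajor's inequality bounds the trace of [C] by its shattered sets. Those of size below [d] are at
   most as many as the trace of [D], which is maximum on [J]; the others are the top sets. *)
have le : (#|trace C J :\: trace D J| <= #|top_sets J|)%N.
  have [_ _ cardD] := maximum_trace JU maxD.
  rewrite cardsD (setIidPr _) ?imsetS // cardD leq_subLR.
  have CJ : trace C J \subset powerset J.
    by apply/subsetP => _ /imsetP[A _ ->]; rewrite inE subsetIr.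
  apply: leq_trans (card_le_shattered CJ) _.
  apply: leq_trans (leq_of_leqif (leq_card_setU _ _)).
  apply: subset_leq_card; apply/subsetP => S; rewrite !inE => /andP[SJ].
  rewrite shattered_trace // => sh; rewrite SJ sh andbT /=.
  by rewrite orbC -leq_eqVlt vcC.
have MH : {in top_sets J &, forall S S',
    \sum_(p in trace C J :\: trace D J) M S p * H p S' = (S == S')%:R}.
  move=> S S' SJ S'J; have SU := top_setsS JU SJ; have S'U := top_setsS JU S'J.
  have sSJ : S \subset J by move: SJ; rewrite inE => /andP[].
  have sS'J : S' \subset J by move: S'J; rewrite inE => /andP[].
  (* The sum may run over the whole cube: its points lie in the trace of [C], and the indicator of
     [label S'] vanishes on the trace of [D]. *)
  transitivity (\sum_(p : {set T} | p :\: S == (corner S :&: J) :\: S)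
      ((-1) ^+ #|p :&: S| * (p :&: S' == label S')%:R) * (-1) ^+ #|label S| : int).
    rewrite big_mkcond [RHS]big_mkcond; apply: eq_bigr => q _; rewrite /M /H.
    rewrite exprD.
    have [Eq | _] := eqVneq (q :\: S) _; last by rewrite !mul0r if_same.
    rewrite mul1r mulrAC; case: ifP => // /negbT qP.
    have [q' | _] := eqVneq (q :&: S') _; last by rewrite mulr0 mul0r.
    case/negP: qP; rewrite inE; apply/andP; split.
      apply: contra (label_missed S'U) => /imsetP[A AD qA].
      by rewrite -q' qA -setIA (setIidPr sS'J); apply: imset_f.
    apply/imsetP; exists ((corner S :\: S) :|: (q :&: S)).
      apply: (subsetP (cornerC SU)); rewrite inE setDUl setDDl setUid.
      by rewrite [_ :&: _ :\: _](_ : _ = set0) ?setU0 //;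
        apply/setP => y; rewrite !inE; case: (y \in S); rewrite ?andbF.
    rewrite setIUl setIDAC -Eq -setIA (setIidPl sSJ).
    by rewrite setUC setID.
  rewrite -mulr_suml.
  have [<- | SS'] := eqVneq S S'.
    rewrite (bigD1 ((source S :&: J))) /=; last by rewrite -setIDAC sourceD // setIDAC.
    have sJS : source S :&: J :&: S = label S by rewrite -setIA (setIidPr sSJ) sourceI.
    rewrite sJS eqxx mulr1 big1 ?addr0 => [|q /andP[/eqP Eq nq]].
      by rewrite -expr2 sqrr_sign.
    case: eqP => [Eq'|]; rewrite ?mulr0 //.
    case/eqP: nq; rewrite -(setID q S) Eq Eq' -[RHS](setID _ S) sJS.
    by rewrite -!setIDAC sourceD.
  (* Distinct top sets have the same size [d], so neither contains the other. *)
  rewrite alternating_sum0 ?mul0r //; apply: contraNN SS' => SS'.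
  rewrite eqEcard SS'; move: SJ S'J; rewrite !inE.
  by case/and3P => _ /eqP -> _ /and3P[_ /eqP -> _] /=.
have /(_ p pP) := dual_system_swap le MH.
(* A nonzero term determines [p] both inside and outside [S], so [p] is the trace of [source S], and
   the two signs cancel to 1. *)
have -> : \sum_(S in top_sets J) H p S * M S p =
    #|[set S in top_sets J | source S :&: J == p]|%:R.
  rewrite -sum1_card natr_sum big_mkcond [RHS]big_mkcond; apply: eq_bigr => S _.
  rewrite inE; case: ifP => //= SJ; have SU := top_setsS JU SJ.
  have sSJ : S \subset J by move: SJ; rewrite inE => /andP[].
  have sJS : source S :&: J :&: S = label S by rewrite -setIA (setIidPr sSJ) sourceI.
  have sJD : source S :&: J :\: S = corner S :&: J :\: S by rewrite -!setIDAC sourceD.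
  rewrite /H /M; have [<- | np] := eqVneq (source S :&: J) p.
    by rewrite sJS sJD !eqxx !mul1r addnn -signr_odd odd_double.
  have [Eq|] := eqVneq (p :&: S) _; rewrite ?mul0r //.
  have [Eq'|] := eqVneq (p :\: S) _; rewrite ?mul0r ?mulr0 //.
  by case/eqP: np; rewrite -(setID p S) Eq Eq' -[LHS](setID _ S) sJS sJD.
by move/eqP; rewrite (eqr_nat _ _ 1) => /eqP.
Qed.

End Sources.

(** * Extending, lifting and constructing schemes *)

Section Schemes.

Variable T : finType.
Implicit Types (C D F : {set {set T}}) (A B S U : {set T}) (r : {set T} -> {set T}).

(** The size bound is strict, to match the index of [maximum_family]: [e] is one more than the size
    of the scheme. *)
Definition family_scheme U e F r :=
  [/\ {in F &, injective r},
      {in F, forall A, (r A \subset U) && (#|r A| < e)} &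
      {in F &, forall A B, A != B ->
         A :&: (r A :|: r B) != B :&: (r A :|: r B)}].

Lemma clash_subset A B S S' :
  S \subset S' -> A :&: S != B :&: S -> A :&: S' != B :&: S'.
Proof.
move=> SS'; apply: contra_neq => E.
by rewrite -(setIidPr SS') !setIA E.
Qed.

(** New points receive sets of size exactly [d] and points of [D] keep smaller ones, which separates
    the two kinds. The lemma serves both for the given class and, in the induction for maximum
    families, for the restriction over the reduction; there [lift_scheme] needs the strict bound on
    [D]. *)
Lemma extend_scheme U d C D r0 :
  maximum_family U d D -> C \subset powerset U -> D \subset C ->
  (forall S, shattered C S -> #|S| <= d) ->
  (forall S, shattered C S -> #|S| = d -> exists A, cube_at S A \subset C) ->
  family_scheme U d D r0 ->
  exists2 r, family_scheme U d.+1 C r & {in D, forall A, #|r A| < d}.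
Proof.
move=> maxD CU DC vcC cubeC [injr0 sizer0 clashr0].
(* The default [set0] is never reached on top sets, by [cornerP] and [labelP] below. *)
pose corner S := odflt set0 [pick A : {set T} | cube_at S A \subset C].
pose label S := odflt set0 [pick X : {set T} | (X \subset S) && (X \notin trace D S)].
have [DU vcD _] := maxD.
have cornerP S : S \in top_sets d C U -> cube_at S (corner S) \subset C.
  rewrite inE => /and3P[_ /eqP Sd sh]; rewrite /corner; case: pickP => //= no.
  by have [A cA] := cubeC S sh Sd; have := no A; rewrite /= cA.
have labelP S : S \in top_sets d C U ->
    (label S \subset S) && (label S \notin trace D S).
  rewrite inE => /and3P[_ /eqP Sd _]; rewrite /label; case: pickP => //= no.
  have /vcD : shattered D S; last by rewrite Sd ltnn.
  by apply/subsetP => X; rewrite inE => XS; have /= := no X; rewrite XS => /negbFE.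
have label_sub S St := proj1 (andP (labelP S St)).
have label_missed S St := proj2 (andP (labelP S St)).
have cardS := card_source maxD vcC label_sub label_missed cornerP.
pose r A := if A \in D then r0 A else
  odflt set0 [pick S in top_sets d C U | source corner label S == A].
have rD A : A \in D -> r A = r0 A by rewrite /r => ->.
have rP A : A \in C -> A \notin D ->
    r A \in top_sets d C U /\ source corner label (r A) = A.
  move=> AC AD; rewrite /r (negPf AD); case: pickP => [S /andP[St /eqP] // | no].
  have setIU B : B \in C -> B :&: U = B.
    by move/(subsetP CU); rewrite inE => /setIidPl.
  (* The count of sources is applied with [J := U], where taking traces changes no point of [C]. *)
  have AP : A \in trace C U :\: trace D U.
    rewrite inE; apply/andP; split; last by rewrite -(setIU A AC); apply: imset_f.
    apply: contra AD => /imsetP[B BD ->].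
    by rewrite setIU //; apply: (subsetP DC).
  have /eqP := cardS _ _ (subxx U) DC AP.
  case/cards1P => S /setP/(_ S); rewrite set11 inE => /andP[St].
  rewrite (setIU _ (source_in label_sub cornerP St)) => SA.
  by have := no S; rewrite /= St SA.
have card_r A : A \in C -> A \notin D -> #|r A| = d.
  by move=> AC AD; have [] := rP A AC AD; rewrite inE => /and3P[_ /eqP].
have label_r A : A \in C -> A \notin D -> label (r A) = A :&: r A.
  by move=> AC AD; have [St E] := rP A AC AD; rewrite -(sourceI corner label_sub St) E.
have traceN A B : A \in C -> A \notin D -> B \in D -> A :&: r A != B :&: r A.
  move=> AC AD BD; have [St _] := rP A AC AD.
  apply: contraNneq (label_missed _ St) => E; rewrite label_r // E.
  exact: imset_f.
exists r; last by move=> A AD; rewrite rD //; case/andP: (sizer0 A AD).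
split.
- move=> A B AC BC E; have [AD|AD] := boolP (A \in D); have [BD|BD] := boolP (B \in D).
  + by apply: injr0; rewrite // -!rD.
  + by case/andP: (sizer0 A AD) => _; rewrite -rD // E card_r // ltnn.
  + by case/andP: (sizer0 B BD) => _; rewrite -rD // -E card_r // ltnn.
  + by have [_ <-] := rP A AC AD; have [_ <-] := rP B BC BD; rewrite E.
- move=> A AC; have [AD|AD] := boolP (A \in D).
    by rewrite rD //; case/andP: (sizer0 A AD) => -> /ltnW.
  rewrite card_r // ltnSn andbT.
  by have [] := rP A AC AD; rewrite inE => /and3P[].
move=> A B AC BC AB; have [AD|AD] := boolP (A \in D); have [BD|BD] := boolP (B \in D).
- by rewrite !rD //; apply: clashr0.
- by apply: clash_subset (subsetUr _ _) _; rewrite eq_sym traceN.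
- by apply: clash_subset (subsetUl _ _) _; rewrite traceN.
have [SA EA] := rP A AC AD; have [SB EB] := rP B BC BD.
(* If [A] and [B] agreed on [J], then [r A] and [r B] would be top sets within [J] whose sources
   have the same trace; uniqueness gives [r A = r B], hence [A = B]. *)
apply: contra_neq AB => E; set J := r A :|: r B in E.
have JU : J \subset U.
  by move: SA SB; rewrite !inE subUset => /and3P[-> _ _] /and3P[-> _ _].
have pP : A :&: J \in trace C J :\: trace D J.
  rewrite inE; apply/andP; split; last exact: imset_f.
  apply/imsetP => -[B' B'D E'].
  have /negP := traceN A B' AC AD B'D; apply; apply/eqP.
  by rewrite -(setIidPr (subsetUl (r A) (r B))) !setIA -/J E'.
have /eqP/cards1P[S /setP ES] := cardS _ _ JU DC pP.
have rJ X : (X = A) \/ (X = B) -> r X = S.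
  move=> XAB; apply/set1P; rewrite -ES.
  case: XAB => ->; move: SA SB; rewrite !inE.
    by move=> /and3P[_ -> ->] _; rewrite subsetUl EA eqxx.
  by move=> _ /and3P[_ -> ->]; rewrite subsetUr EB E eqxx.
by rewrite -EA -EB !rJ; auto.
Qed.

(** Two points of [F] merge in the restriction exactly over a point of the reduction. Adding [x] to
    the set of the one containing [x] separates them, and the sets there are small enough to leave
    room for [x]. *)
Lemma lift_scheme x U e F r :
  x \in U ->
  family_scheme (U :\ x) e.+1 (restriction x F) r ->
  {in reduction x F, forall A, #|r A| < e} ->
  exists r', family_scheme U e.+1 F r'.
Proof.
move=> xU [injr sizer clashr] sizeR.
pose t A := (A :\ x \in reduction x F) && (x \in A).
pose r' A := if t A then x |: r (A :\ x) else r (A :\ x).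
have resF A : A \in F -> A :\ x \in restriction x F by move=> AF; apply: imset_f.
have xr A : A \in F -> x \notin r (A :\ x).
  by move/resF/sizer; rewrite subsetD1 => /andP[/andP[]].
have r'x A : A \in F -> (x \in r' A) = t A.
  by rewrite /r' => AF; case: (t A); rewrite ?setU11 // (negPf (xr A AF)).
have r'D A : A \in F -> r' A :\ x = r (A :\ x).
  by rewrite /r' => AF; case: (t A); [rewrite setU1K ?xr | rewrite (setD1_id (xr A AF))].
have sub_r' A : r (A :\ x) \subset r' A.
  by rewrite /r'; case: (t A); rewrite ?subsetUr.
have same A B : A \in F -> B \in F -> A :\ x = B :\ x -> A != B ->
    (x \in A) != (x \in B) /\ A :\ x \in reduction x F.
  move=> AF BF E AB.
  have xAB : (x \in A) != (x \in B).
    apply: contra_neq AB => xAB; apply/setP => y.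
    have [-> // | yx] := eqVneq y x.
    by move/setP/(_ y): E; rewrite !inE yx.
  split=> //; rewrite !inE eqxx /=.
  move: xAB; have [xA|xA] := boolP (x \in A) => xB.
    have xB' : x \notin B by case: (x \in B) xB.
    by rewrite setD1K // AF E setD1_id // BF.
  have xB' : x \in B by case: (x \in B) xB.
  by rewrite E setD1K // BF -E setD1_id // AF.
exists r'; split.
- move=> A B AF BF E.
  have ED : A :\ x = B :\ x by apply: injr; rewrite ?resF // -!r'D // E.
  apply/eqP; apply/negPn/negP => AB; have [xAB AR] := same A B AF BF ED AB.
  move: (congr1 (fun S => x \in S) E) xAB; rewrite !r'x // /t -ED AR /= => ->.
  by rewrite eqxx.
- move=> A AF; have /andP[rU re] := sizer _ (resF A AF).
  have rU' := subset_trans rU (subD1set U x).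
  rewrite /r'; case: ifP => [/andP[AR xA] | _]; last by rewrite rU'.
  by rewrite subUset sub1set xU rU' cardsU1 xr // ltnS sizeR.
move=> A B AF BF AB; have [ED | ED] := eqVneq (A :\ x) (B :\ x).
  have [xAB AR] := same A B AF BF ED AB.
  apply: contra_neq xAB => /setP/(_ x); rewrite !inE !r'x // /t -ED AR /=.
  by case: (x \in A); case: (x \in B).
have := clashr _ _ (resF A AF) (resF B BF) ED.
set S := r _ :|: r _ => neS.
(* The clash-free set [S] avoids [x], so the difference found after deleting [x] persists before. *)
have xS : x \notin S by rewrite inE negb_or !xr.
have SD X : (X :\ x) :&: S = X :&: S.
  by rewrite setIDAC setD1_id // inE (negPf xS) andbF.
rewrite !SD in neS; apply: clash_subset neS.
by rewrite setUSS.
Qed.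

Lemma maximum_scheme U e F :
  maximum_family U e F -> exists r, family_scheme U e F r.
Proof.
have [k] := ubnP #|U|; elim: k U e F => // k IHk U e F ltk maxF.
have [FU vcF cardF] := maxF.
case: e => [|e] in maxF vcF cardF *.
  by exists id; rewrite (maximum_family0 maxF); split=> A; rewrite inE.
have [U0 | [x xU]] := set_0Vmem U.
  have F0 A : A \in F -> A = set0.
    by move/(subsetP FU); rewrite U0 powerset0 inE => /eqP.
  exists (fun=> set0); split=> [A B /F0 -> /F0 -> // | A _ | A B /F0 -> /F0 ->].
    by rewrite sub0set cards0.
  by rewrite eqxx.
have [maxR maxD] := maximum_restriction_reduction xU maxF.
have ltUk : #|U :\ x| < k by move: ltk; rewrite (cardsD1 x) xU.
(* The reduction plays the role of [D] and the restriction that of [C] in [extend_scheme]. *)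
have [r0 scheme0] := IHk _ _ _ ltUk maxD.
have [RU vcR _] := maxR.
have [|r schemer sizer] := extend_scheme maxD RU (reduction_restriction x F) vcR _ scheme0.
  move=> S sh Se; apply: (maximum_cube maxR); last by rewrite Se.
  exact: shattered_powerset RU sh.
exact: (lift_scheme xU schemer sizer).
Qed.

End Schemes.

(** * Translation from Boolean points to their supports *)

Section Supports.

Variable n : nat.
Implicit Types (u v w : point n) (C D : {set point n}) (I : {set 'I_n}).

Definition supp v := [set i | v i].

Lemma supp_inj : injective supp.
Proof. by move=> v w /setP E; apply/ffunP => i; have := E i; rewrite !inE. Qed.

Lemma proj_supp I v w : (proj I v == proj I w) = (supp v :&: I == supp w :&: I).
Proof.
apply/eqP/eqP => [/ffunP E | /setP E].
  apply/setP => i; rewrite !inE; case: (boolP (i \in I)) => iI; rewrite ?andbF //.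
  by have := E (exist _ i iI); rewrite !ffunE /= => ->.
apply/ffunP => -[i iI]; rewrite !ffunE /=.
by have := E i; rewrite !inE iI !andbT.
Qed.

Lemma proj_surj I (s : subpoint I) : exists v, proj I v = s.
Proof.
exists [ffun i => oapp s false (insub i)]; apply/ffunP => -[i iI].
by rewrite !ffunE /= insubT.
Qed.

Definition supports C := [set supp v | v in C].

Lemma mem_supports C v : (supp v \in supports C) = (v \in C).
Proof. exact: (mem_imset _ _ supp_inj). Qed.

Lemma suppK (A : {set 'I_n}) : supp [ffun i => i \in A] = A.
Proof. by apply/setP => i; rewrite inE ffunE. Qed.

Lemma shattered_supports C I : shattered (supports C) I = shatters C I.
Proof.
apply/shatteredP/eqP => [sh | E X XI].
  apply/setP => s; rewrite inE; have [v <-] := proj_surj s.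
  have [_ /imsetP[w wC ->] E] := sh _ (subsetIr (supp v) I).
  by apply/imsetP; exists w => //; apply/eqP; rewrite proj_supp E.
pose v : point n := [ffun i => i \in X].
have : proj I v \in [set: subpoint I] by rewrite inE.
rewrite -E => /imsetP[w wC /eqP]; rewrite proj_supp suppK (setIidPl XI) => /eqP ->.
by exists (supp w); rewrite ?mem_supports.
Qed.

Lemma vcdim_bound C I : shattered (supports C) I -> #|I| <= vcdim C.
Proof.
by rewrite shattered_supports; apply: (leq_bigmax_cond (F := fun I => #|I|)).
Qed.

Lemma cube_supports I v (B : {set 'I_n}) C :
  cube (proj (~: I) v) \subset C -> cube_at I (supp v) \subset supports C.
Proof.
move=> /subsetP cC; apply/subsetP => A; rewrite inE !setDE => E.
by rewrite -(suppK A) mem_supports cC // inE proj_supp suppK.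
Qed.

End Supports.

Theorem theorem6p1 (n d : nat) (C D : {set point n})
    (C_extremal : extremal C) (C_vcdim : vcdim C = d)
    (D_maximum : maximum_class D) (D_vcdim : (vcdim D).+1 = d)
    (D_sub_C : D \subset C) :
  has_compression_scheme C d.
Proof.
have powT (F : {set {set 'I_n}}) : F \subset powerset setT.
  by apply/subsetP => A _; rewrite inE subsetT.
(* The index is [d] itself, one more than the dimension of [D]. *)
have maxD : maximum_family setT d (supports D).
  split=> // [S /vcdim_bound|]; first by rewrite -D_vcdim.
  rewrite card_small_subsets cardsT card_ord -D_vcdim card_imset //.
  exact: supp_inj.
have [r0 scheme0] := maximum_scheme maxD.
have [||r [injr sizer clashr] _] :=
  extend_scheme maxD (powT (supports C)) (imsetS _ D_sub_C) _ _ scheme0.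
- by move=> S /vcdim_bound; rewrite C_vcdim.
- move=> S; rewrite shattered_supports => /C_extremal[u]; have [v <-] := proj_surj u.
  by move=> /cube_supports cC _; exists (supp v); apply: cC.
exists (r \o @supp n); split=> [v w vC wC /injr E | v vC | v w vC wC vw].
- by apply/supp_inj/E; rewrite mem_supports.
- by have /andP[_] := sizer (supp v) (etrans (mem_supports C v) vC).
by rewrite proj_supp clashr ?mem_supports ?(inj_eq (@supp_inj n)).
Qed.
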